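(* Let $D_1$ and $D_2$ be non-empty persistence diagrams. Fix a real $\eta>0$ such that $$\eta^2=\min\left\{1,\ \frac{\|\varphi(D_1)\|^2}{8}\left(W_\infty(D_1,\emptyset)+\frac13\right)^{-1},\ \frac{\|\varphi(D_2)\|^2}{8}\left(W_\infty(D_2,\emptyset)+\frac13\right)^{-1}\right\}.$$ Then there are positive constants $c_1$ and $c_2$, which depend on $D_1$ and $D_2$, such that $$\left|\varsigma(\tilde D_1,\tilde D_2)-\varsigma(D_1,D_2)\right|\le c_1\cdot W_2(D_1,\tilde D_1)+c_2\cdot W_2(D_2,\tilde D_2)$$ for any pair of non-empty persistence diagrams $\tilde D_1$ and $\tilde D_2$ with $W_2(D_1,\tilde D_1)\le\eta$ and $W_2(D_2,\tilde D_2)\le\eta$.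
   Context: Fix $\theta_0\in\mathbb{R}$ (the minimum filtration value). A persistence diagram is a finite multiset $D$ (points may have multiplicities) of points $(b,d)\in\mathbb{R}^2$ with $\theta_0\le b<d<\infty$. The empty diagram is denoted $\emptyset$. The diagonal is $\Delta=\{(\theta,\theta)\mid\theta\ge\theta_0\}$. Distances: for diagrams $D_1,D_2$, let $\Gamma$ be the set of all bijections $\gamma:D_1^\Delta\to D_2^\Delta$, where $D_i^\Delta$ is any multiset obtained from $D_i$ by adding a finite number of points of $\Delta$ (allowing multiplicities); the added points may vary with $\gamma$. With $\|\cdot\|_\infty$ on points being the supremum norm of $\mathbb{R}^2$, the bottleneck distance is $$W_\infty(D_1,D_2)=\inf_{\gamma\in\Gamma}\ \sup_{x\in D_1^\Delta}\|x-\gamma(x)\|_\infty,$$ and for $p\ge1$ (real) the $p$-Wasserstein distance is $$W_p(D_1,D_2)=\inf_{\gamma\in\Gamma}\Big(\sum_{x\in D_1^\Delta}\|x-\gamma(x)\|_\infty^p\Big)^{1/p}.$$ (A supremum over the empty set is $0$.) Persistence landscape: if $D$ has points $(b_1,d_1),\dots,(b_n,d_n)$ (listed with multiplicity), let $g_i:\mathbb{R}\to\mathbb{R}$ be $g_i(t)=t-b_i$ for $t\in[b_i,(b_i+d_i)/2]$, $g_i(t)=d_i-t$ for $t\in[(b_i+d_i)/2,d_i]$, and $g_i(t)=0$ otherwise. For $j\ge1$ let $\lambda_j(t)$ be the $j$-th largest value (counted with multiplicity) among $g_1(t),\dots,g_n(t)$, with $\lambda_j(t)=0$ for $j>n$.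 The persistence landscape of $D$ is $\varphi(D)=(\lambda_1,\lambda_2,\dots)$; in particular $\varphi(\emptyset)=0$. For landscapes $\vec\lambda=(\lambda_j)_{j\ge1}$ and $\vec\mu=(\mu_j)_{j\ge1}$, the inner product is $\langle\vec\lambda,\vec\mu\rangle=\sum_{j=1}^\infty\int_{\mathbb{R}}\lambda_j(t)\mu_j(t)\,dt$, and $\|\vec\lambda\|=\langle\vec\lambda,\vec\lambda\rangle^{1/2}$ is the $2$-norm. The (landscape) cosine similarity of non-empty diagrams $D_1,D_2$ is $$\varsigma(D_1,D_2)=\frac{\langle\varphi(D_1),\varphi(D_2)\rangle}{\|\varphi(D_1)\|\,\|\varphi(D_2)\|}.$$ *)

(* Defs.v *)
From HB Require Import structures.
From mathcomp Require Import all_boot all_order all_algebra.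
From mathcomp Require Export finmap multiset.
From mathcomp Require Import all_classical all_reals all_analysis.

Set Implicit Arguments.
Unset Strict Implicit.
Unset Printing Implicit Defensive.
Import Order.TTheory GRing.Theory Num.Theory.
Import numFieldNormedType.Exports.

Local Open Scope mset_scope.
Local Open Scope classical_set_scope.
Local Open Scope ring_scope.

Definition persistence_diagram (R : realType) (theta0 : R)
    (D : {mset R * R}) : Prop :=
  forall x, x \in D -> theta0 <= x.1 /\ x.1 < x.2.

Definition pd_diagonal (R : realType) (theta0 : R) : set (R * R) :=
  [set x | exists2 theta, theta0 <= theta & x = (theta, theta)].

Definition diagonal_augmentation (R : realType) (theta0 : R)
    (D E : {mset R * R}) : Prop :=
  exists2 F : {mset R * R},
    (forall x, x \in F -> pd_diagonal theta0 x) & E = (D `+` F)%mset.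

(* A bijection between two finite multisets is a bijection between the
   positions of their enumerations, so that copies of a repeated point can be
   sent to different points. *)
Definition displacement (R : realType) (E1 E2 : {mset R * R})
    (gamma : 'I_(size E1) -> 'I_(size E2)) (i : 'I_(size E1)) : R :=
  (* the library norm on a product is the maximum of the componentwise norms *)
  `|nth 0 E1 i - nth 0 E2 (gamma i)|.

(* All the displacements are nonnegative, so starting the iterated maximum
   from 0 only fixes the supremum over the empty set. *)
Definition bottleneck (R : realType) (theta0 : R) (D1 D2 : {mset R * R}) : R :=
  inf [set r | exists (E1 E2 : {mset R * R}) (gamma : 'I_(size E1) -> 'I_(size E2)),
    [/\ diagonal_augmentation theta0 D1 E1,
        diagonal_augmentation theta0 D2 E2,
        bijective gamma &
        r = \big[Num.max/0]_i displacement gamma i]].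

(* Meant for p >= 1. *)
Definition wasserstein (R : realType) (theta0 p : R)
    (D1 D2 : {mset R * R}) : R :=
  inf [set r | exists (E1 E2 : {mset R * R}) (gamma : 'I_(size E1) -> 'I_(size E2)),
    [/\ diagonal_augmentation theta0 D1 E1,
        diagonal_augmentation theta0 D2 E2,
        bijective gamma &
        r = (\sum_i displacement gamma i `^ p) `^ p^-1]].

Definition tent (R : realType) (x : R * R) (t : R) : R :=
  let m := (x.1 + x.2) / 2 in
  if x.1 <= t <= m then t - x.1
  else if m <= t <= x.2 then x.2 - t
  else 0.

(* The layers are numbered from 1; the value at j = 0 is irrelevant. *)
Definition landscape (R : realType) (D : {mset R * R}) (j : nat) (t : R) : R :=
  nth 0 (sort >=%R [seq tent x t | x <- D]) j.-1.

(* For landscapes of diagrams all the integrals are finite and only finitely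
   many of them are nonzero, so the total operators below take their genuine
   values. *)
Definition landscape_inner (R : realType) (l m : nat -> R -> R) : R :=
  limn (fun n => \sum_(1 <= j < n) \int[lebesgue_measure]_t (l j t * m j t)).

Definition landscape_norm (R : realType) (l : nat -> R -> R) : R :=
  Num.sqrt (landscape_inner l l).

Definition cosine_similarity (R : realType) (D1 D2 : {mset R * R}) : R :=
  landscape_inner (landscape D1) (landscape D2) /
    (landscape_norm (landscape D1) * landscape_norm (landscape D2)).

(* Main.v *)
Require Import Defs.
From mathcomp Require Import all_boot all_order all_algebra.
From mathcomp Require Import all_classical all_reals all_analysis.
From mathcomp Require Import measurable_realfun ring lra.

(** The cosine of the angle between two vectors of a pre-Hilbert space is a
    Lipschitz function of the vectors, as long as the reference vectors do not
    vanish: normalizing [u'] instead of [u] moves the unit vector by at most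
    [2 |u - u'| / |u|], whatever [u'] is ([semi_inner_cosine_dist]).  The
    constants of the theorem therefore only involve the norms of the two fixed
    landscapes, and it suffices to bound the distance of the landscapes of two
    diagrams by a multiple of the Wasserstein distance
    ([landscape_dist_wasserstein]).

    For that bound, take a matching of two augmented diagrams.  At a given time
    the layers of a landscape are the sorted values of the tents, and sorting
    two lists never increases the sum of the squares of their differences
    ([sum_sort_dist]); so the landscapes are at least as close as the matched
    tents.  Two tents differ by at most the distance [e] of their points, and
    only over the union of their supports, whose length is at most
    [2 L + 2 e] if [L] bounds the lengths of the bars of the fixed diagram.
    Hence the squared distance of the landscapes is at most the sum of the
    [e ^+ 2 * (2 * L + 2 * e)] ([landscape_matching]).  Each [e] is at most the
    cost [r] of the matching, so this sum is at most
    [r ^+ 2 * (2 * L + 2 * r)], and the infimum over the matchings yields a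
    linear bound for distances at most 1, which the bound by [eta] ensures.

    The same comparison of sorted lists, applied to the tents of one diagram at
    two different times, shows that the layers are Lipschitz functions of time,
    hence measurable. *)

Set Implicit Arguments.
Unset Strict Implicit.
Unset Printing Implicit Defensive.
Import Order.TTheory GRing.Theory Num.Theory.
Import numFieldNormedType.Exports.
Local Open Scope mset_scope.
Local Open Scope ring_scope.

(** * Cosine similarity for a positive semidefinite form *)

(** The form is only required to be bilinear on a subspace [P], because the
    inner product of landscapes is a total operator on all sequences of
    functions, with junk values where the integrals diverge. *)
Record semi_inner (R : realType) (V : lmodType R) (P : V -> Prop)
    (ip : V -> V -> R) : Prop := SemiInner {
  semi_inner_closed : forall a u v, P u -> P v -> P (a *: u + v);
  semi_inner_linear : forall a u v w, P u -> P v -> P w ->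
    ip (a *: u + v) w = a * ip u w + ip v w;
  semi_inner_sym : forall u v, P u -> P v -> ip u v = ip v u;
  semi_inner_ge0 : forall u, P u -> 0 <= ip u u }.

Section SemiInner.
Variables (R : realType) (V : lmodType R) (P : V -> Prop) (ip : V -> V -> R).
Hypothesis ipP : semi_inner P ip.
Implicit Types u v w : V.

Local Notation nrm u := (Num.sqrt (ip u u)).

Lemma semi_inner_sub u v : P u -> P v -> P (u - v).
Proof.
by move=> Pu Pv; rewrite addrC -scaleN1r; apply: (semi_inner_closed ipP).
Qed.

Lemma semi_innerBl u v w :
  P u -> P v -> P w -> ip (u - v) w = ip u w - ip v w.
Proof.
move=> Pu Pv Pw; rewrite addrC -scaleN1r (semi_inner_linear ipP) //.
by rewrite mulN1r addrC.
Qed.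

Lemma semi_inner_expand a u v : P u -> P v ->
  ip (a *: u + v) (a *: u + v) = a ^+ 2 * ip u u + 2 * a * ip u v + ip v v.
Proof.
move=> Pu Pv; have Pauv := semi_inner_closed ipP a Pu Pv.
rewrite (semi_inner_linear ipP) //.
rewrite (semi_inner_sym ipP Pu) // (semi_inner_sym ipP Pv) //.
rewrite !(semi_inner_linear ipP) // (semi_inner_sym ipP Pv Pu).
by ring.
Qed.

Lemma semi_inner_cauchy_schwarz u v :
  P u -> P v -> `|ip u v| <= nrm u * nrm v.
Proof.
move=> Pu Pv.
have uu := semi_inner_ge0 ipP Pu; have vv := semi_inner_ge0 ipP Pv.
have quad a : 0 <= a ^+ 2 * ip u u + 2 * a * ip u v + ip v v.
  by rewrite -semi_inner_expand //; apply: (semi_inner_ge0 ipP);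
     apply: (semi_inner_closed ipP).
rewrite -sqrtrM // -sqrtr_sqr ler_wsqrtr //.
have [uu0|uu_neq0] := eqVneq (ip u u) 0.
  have [->|uv_neq0] := eqVneq (ip u v) 0; first by rewrite expr0n uu0 mul0r.
  (* the polynomial is affine, and would be -1 at this point *)
  have := quad (- (ip v v + 1) / (2 * ip u v)); rewrite uu0 mulr0 add0r.
  have -> : 2 * (- (ip v v + 1) / (2 * ip u v)) * ip u v = - (ip v v + 1).
    by field.
  by move=> ?; exfalso; lra.
have uu_gt0 : 0 < ip u u by rewrite lt_neqAle eq_sym uu_neq0.
(* the minimum of the quadratic polynomial *)
have := quad (- ip u v / ip u u).
have -> : (- ip u v / ip u u) ^+ 2 * ip u u
    + 2 * (- ip u v / ip u u) * ip u v + ip v v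
  = (ip u u * ip v v - ip u v ^+ 2) / ip u u by field.
by rewrite pmulr_lge0 ?invr_gt0 // subr_ge0.
Qed.

Lemma semi_inner_norm_dist u v :
  P u -> P v -> `|nrm u - nrm v| <= nrm (u - v).
Proof.
move=> Pu Pv.
rewrite -sqrtr_sqr ler_wsqrtr //.
rewrite [u - v]addrC -scaleN1r semi_inner_expand //.
have := le_trans (ler_norm _) (semi_inner_cauchy_schwarz Pv Pu).
rewrite sqrrB !sqr_sqrtr ?(semi_inner_ge0 ipP) //.
set a := nrm u; set b := nrm v => ?.
by rewrite -[a * b *+ 2]mulr_natl; lra.
Qed.

(** Replacing [u] by [u'] in the numerator costs [|u - u'|], and so does
    replacing [|u|] by [|u'|] in the denominator, since [|ip u' w|] is at most
    [|u'| * |w|].  If [|u'| = 0], the quotient by [|u'|] is 0 and so is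
    [ip u' w]; the bound then still holds because [|u - u'|] and [|u|] agree up
    to [|u'|]. *)
Lemma semi_inner_normalized_dist u u' w : P u -> P u' -> P w -> 0 < nrm u ->
  `|ip u' w / nrm u' - ip u w / nrm u| <= 2 * nrm (u - u') / nrm u * nrm w.
Proof.
move=> Pu Pu' Pw u_gt0.
have csd := semi_inner_cauchy_schwarz (semi_inner_sub Pu Pu') Pw.
have cs' := semi_inner_cauchy_schwarz Pu' Pw.
have csu := semi_inner_norm_dist Pu Pu'.
rewrite semi_innerBl // in csd.
have a'_ge0 : 0 <= nrm u' by exact: sqrtr_ge0.
have d_ge0 : 0 <= nrm (u - u') by exact: sqrtr_ge0.
have w_ge0 : 0 <= nrm w by exact: sqrtr_ge0.
move: (nrm u) (nrm u') (nrm w) (nrm (u - u')) (ip u w) (ip u' w) u_gt0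
  csd cs' csu a'_ge0 d_ge0 w_ge0 => a a' c d x x' a_gt0 csd cs' csu a'0 d0 c0.
have a_neq0 : a != 0 by rewrite gt_eqF.
have [a'E|a'_neq0] := eqVneq a' 0.
  have x'0 : x' = 0 by apply/eqP; rewrite -normr_le0 (le_trans cs') // a'E mul0r.
  rewrite x'0 mul0r sub0r normrN normrM normfV (gtr0_norm a_gt0).
  rewrite [leRHS]mulrAC ler_pM2r ?invr_gt0 //.
  rewrite x'0 subr0 in csd; apply: le_trans csd _.
  by rewrite ler_wpM2r //; lra.
have a'_gt0 : 0 < a' by rewrite lt_neqAle eq_sym a'_neq0.
have -> : x' / a' - x / a = (x' / a' * (a - a') - (x - x')) / a by field; apply/andP.
rewrite normrM normfV (gtr0_norm a_gt0).
rewrite [leRHS]mulrAC ler_pM2r ?invr_gt0 //.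
have -> : 2 * d * c = c * d + d * c by ring.
apply: le_trans (ler_normB _ _) _; apply: lerD => //.
rewrite normrM ler_pM // normrM normfV (gtr0_norm a'_gt0) ler_pdivrMr //.
by rewrite mulrC.
Qed.

(** Change one vector at a time, through the cosine of [u] and [v']. *)
Lemma semi_inner_cosine_dist u u' v v' : P u -> P u' -> P v -> P v' ->
  0 < nrm u -> 0 < nrm v ->
  `|ip u' v' / (nrm u' * nrm v') - ip u v / (nrm u * nrm v)|
    <= 2 / nrm u * nrm (u - u') + 2 / nrm v * nrm (v - v').
Proof.
move=> Pu Pu' Pv Pv' u_gt0 v_gt0.
have du := semi_inner_normalized_dist Pu Pu' Pv' u_gt0.
have := semi_inner_normalized_dist Pv Pv' Pu v_gt0.
rewrite (semi_inner_sym ipP Pv') // (semi_inner_sym ipP Pv) // => dv.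
rewrite -(subrK (ip u v' / (nrm u * nrm v')) (ip u' v' / _)) -addrA.
apply: le_trans (ler_normD _ _) _; apply: lerD.
  rewrite !invfM !mulrA -mulrBl normrM (@ger0_norm _ (_^-1)) ?invr_ge0 ?sqrtr_ge0 //.
  have [->|v'_neq0] := eqVneq (nrm v') 0.
    by rewrite invr0 mulr0 mulr_ge0 ?sqrtr_ge0 // divr_ge0 // ltW.
  have v'_gt0 : 0 < nrm v' by rewrite lt_neqAle eq_sym v'_neq0 sqrtr_ge0.
  by rewrite ler_pdivrMr // (le_trans du) // [2 * _ / _]mulrAC.
rewrite ![Num.sqrt (ip u u) * _]mulrC !invfM !mulrA -mulrBl normrM.
rewrite (@ger0_norm _ (_^-1)) ?invr_ge0 ?sqrtr_ge0 //.
by rewrite ler_pdivrMr // (le_trans dv) // [2 * _ / _]mulrAC.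
Qed.

End SemiInner.

(** * Sorting two lists brings them closer *)

Section Rearrangement.
Variable R : realDomainType.
Implicit Types (x y : R) (s t : seq R).

Local Notation cost s t := (\sum_(p <- zip s t) (p.1 - p.2) ^+ 2).

(** One step of insertion sort: as long as [x] has to go past a larger [z],
    exchanging the two lowers the cost by [2 * ((y - y') * (z - x))], which is
    nonnegative because the other list is already decreasing. *)
Lemma cost_insert y s x t : size s = size t -> path >=%R y s ->
  cost (y :: s) (merge >=%R [:: x] t) <= cost (y :: s) (x :: t).
Proof.
elim: t y s => [|z t IH] y [|y' s] //= [size_st] /andP[y_y' s_sorted].
case: (lerP z x) => [//|/ltW x_z].
rewrite !big_cons /= in IH *.
apply: le_trans (_ : _ <= (y - z) ^+ 2 + ((y' - x) ^+ 2 + cost s t)) _.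
  rewrite lerD2l; have := IH y' s size_st s_sorted.
  by rewrite big_cons.
rewrite !addrA lerD2r -subr_ge0.
have -> : (y - x) ^+ 2 + (y' - z) ^+ 2 - ((y - z) ^+ 2 + (y' - x) ^+ 2)
  = 2 * ((y - y') * (z - x)) by ring.
by rewrite mulr_ge0 // mulr_ge0 // subr_ge0.
Qed.

Lemma sort_cons_merge x t : sort >=%R (x :: t) = merge >=%R [:: x] (sort >=%R t).
Proof.
apply: (sorted_eq ge_trans ge_anti).
- exact: sort_sorted ge_total _.
- apply: (merge_sorted ge_total) => //; exact: sort_sorted ge_total _.
- by rewrite perm_sort perm_sym perm_merge /= perm_cons perm_sort.
Qed.

Lemma cost_sort s t : size s = size t -> sorted >=%R s ->
  cost s (sort >=%R t) <= cost s t.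
Proof.
elim: t s => [|x t IH] [|y s] //= [size_st] s_sorted.
rewrite sort_cons_merge.
apply: le_trans (cost_insert x _ s_sorted) _; first by rewrite size_sort.
by rewrite /= !big_cons lerD2l IH // (path_sorted s_sorted).
Qed.

(** The cost is invariant under a simultaneous permutation of both lists, so
    the first one may be assumed sorted. *)
Lemma cost_sort2 s t : size s = size t ->
  cost (sort >=%R s) (sort >=%R t) <= cost s t.
Proof.
move=> size_st; pose z := sort (relpre fst >=%R) (zip s t).
have zE : perm_eq (zip s t) z by rewrite perm_sym perm_sort.
have z1 : unzip1 z = sort >=%R s.
  by rewrite /z /unzip1 -(@sort_map _ _ fst >=%R) -/(unzip1 _) unzip1_zip // size_st.
have z2 : sort >=%R (unzip2 z) = sort >=%R t.
  apply/perm_sortP; [exact: ge_total|exact: ge_trans|exact: ge_anti|].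
  rewrite -[in X in perm_eq _ X](@unzip2_zip _ _ s t) ?size_st //.
  by rewrite perm_sym perm_map.
rewrite (perm_big _ zE) /= -[z in leRHS]zip_unzip -z1 -z2.
apply: cost_sort; first by rewrite !size_map.
by rewrite z1; exact: sort_sorted ge_total _.
Qed.

Lemma sum_zip_nth s t n : size s = n -> size t = n ->
  cost s t = \sum_(0 <= i < n) (nth 0 s i - nth 0 t i) ^+ 2.
Proof.
move=> ss st; rewrite (big_nth (0, 0)) size_zip ss st minnn.
by apply: eq_big_nat => i _; rewrite nth_zip ?ss ?st.
Qed.

Lemma sum_sort_dist s t n : size s = n -> size t = n ->
  \sum_(0 <= i < n) (nth 0 (sort >=%R s) i - nth 0 (sort >=%R t) i) ^+ 2
    <= \sum_(0 <= i < n) (nth 0 s i - nth 0 t i) ^+ 2.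
Proof.
move=> ss st; rewrite -!sum_zip_nth ?size_sort //.
by apply: cost_sort2; rewrite ss st.
Qed.

End Rearrangement.

(** * Tents *)

Section Tent.
Variable R : realType.
Implicit Types (x y : R * R) (t e : R).

Lemma tent_ge0 x t : 0 <= tent x t.
Proof.
rewrite /tent; case: ifP => [/andP[xt _]|_]; first by rewrite subr_ge0.
by case: ifP => [/andP[_ tx]|//]; rewrite subr_ge0.
Qed.

Lemma tentE x t : x.1 <= x.2 ->
  tent x t = Num.max 0 (Num.min (t - x.1) (x.2 - t)).
Proof.
move=> x12; rewrite /tent.
case: (lerP (t - x.1) (x.2 - t)) => [t_left|t_right].
  have -> : t <= (x.1 + x.2) / 2 by lra.
  rewrite andbT; case: (lerP 0 (t - x.1)); rewrite ?subr_ge0 ?subr_lt0 => xt.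
    by rewrite xt.
  have -> : (x.1 <= t) = false by lra.
  by have -> : ((x.1 + x.2) / 2 <= t) = false by lra.
have -> : (t <= (x.1 + x.2) / 2) = false by lra.
have -> : (x.1 + x.2) / 2 <= t by lra.
rewrite andbF; case: (lerP 0 (x.2 - t)); rewrite ?subr_ge0 ?subr_lt0 => tx.
  by rewrite tx.
by have -> : (t <= x.2) = false by lra.
Qed.

Lemma tent_diag (a t : R) : tent (a, a) t = 0.
Proof.
rewrite tentE //=; case: (lerP (t - a) (a - t)) => ?;
  case: (lerP 0 (t - a)) => ?; case: (lerP 0 (a - t)) => ?; lra.
Qed.

Lemma tent_out x t : ~~ (x.1 <= t <= x.2) -> tent x t = 0.
Proof.
rewrite negb_and -!ltNge /tent => xt; case: ifP => [/andP[? ?]|_].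
  by case/orP: xt => ?; lra.
by case: ifP => [/andP[? ?]|//]; case/orP: xt => ?; lra.
Qed.

Lemma dist_pos_min (a b a' b' e : R) : `|a - a'| <= e -> `|b - b'| <= e ->
  `|Num.max 0 (Num.min a b) - Num.max 0 (Num.min a' b')| <= e.
Proof.
move=> aa' bb'.
have : `|Num.min a b - Num.min a' b'| <= e.
  move: aa' bb'; rewrite !ler_norml => /andP[? ?] /andP[? ?].
  by case: (lerP a b) => ?; case: (lerP a' b') => ?; apply/andP; split; lra.
move: (Num.min a b) (Num.min a' b') => u u'.
rewrite !ler_norml => /andP[? ?].
by case: (lerP 0 u) => ?; case: (lerP 0 u') => ?; apply/andP; split; lra.
Qed.

Lemma tent_dist x y t : x.1 <= x.2 -> y.1 <= y.2 ->
  `|tent x t - tent y t| <= `|x - y|.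
Proof.
move=> x12 y12; rewrite !tentE // prod_normE /=.
apply: dist_pos_min; rewrite le_max; apply/orP.
  left; have -> : t - x.1 - (t - y.1) = y.1 - x.1 by ring.
  by rewrite distrC.
right; have -> : x.2 - t - (y.2 - t) = x.2 - y.2 by ring.
by [].
Qed.

Lemma tent_lipschitz x t t' : x.1 <= x.2 -> `|tent x t - tent x t'| <= `|t - t'|.
Proof.
move=> x12; rewrite !tentE //; apply: dist_pos_min.
  have -> : t - x.1 - (t' - x.1) = t - t' by ring.
  by [].
have -> : x.2 - t - (x.2 - t') = t' - t by ring.
by rewrite distrC.
Qed.

(** Controls the support of the second of two matched tents, about which
    nothing else is known. *)
Lemma length_dist x y : y.2 - y.1 <= x.2 - x.1 + 2 * `|x - y|.
Proof.
rewrite prod_normE /=; have := le_max `|x.1 - y.1| `|x.1 - y.1| `|x.2 - y.2|.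
have := le_max `|x.2 - y.2| `|x.1 - y.1| `|x.2 - y.2|.
rewrite !lexx orbT /= => h2 h1.
have := ler_norm (x.1 - y.1); have := ler_norm (- (x.2 - y.2)).
rewrite normrN; lra.
Qed.

End Tent.

(** * Layers of a list of bars *)

Section Layer.
Variable R : realType.
Implicit Types (X Y : seq (R * R)) (t : R).

(** Landscapes of plain lists of bars, numbered from 0: the target of a matching
    has to be listed in the order of its source, which a multiset forgets. *)
Definition layer X j t : R := nth 0 (sort >=%R [seq tent x t | x <- X]) j.

Lemma layer_perm X Y : perm_eq X Y -> layer X = layer Y.
Proof.
move=> XY; apply/funext => j; apply/funext => t; rewrite /layer.
congr (nth 0 _ j).
by apply/perm_sortP;
  [exact: ge_total|exact: ge_trans|exact: ge_anti|exact: perm_map].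
Qed.

(** Diagonal points have zero tents, and as tents are nonnegative these zeros
    come last in the sorted list, where they agree with the default value. *)
Lemma layer_cat_diag X Y : (forall y, y \in Y -> y.1 = y.2) ->
  layer (X ++ Y) = layer X.
Proof.
move=> diagY; apply/funext => j; apply/funext => t; rewrite /layer map_cat.
have /all_pred1P -> : all (pred1 0) [seq tent y t | y <- Y].
  by apply/allP => _ /mapP[[a b] /diagY /= -> ->] /=; rewrite tent_diag.
set s := [seq tent x t | x <- X]; set z := nseq _ _.
have -> : sort >=%R (s ++ z) = sort >=%R s ++ z.
  apply: (sorted_eq ge_trans ge_anti); first exact: sort_sorted ge_total _.
    rewrite (sorted_pairwise ge_trans) pairwise_cat -!(sorted_pairwise ge_trans).
    apply/and3P; split.
    - apply/allrelP => a b; rewrite mem_sort => /mapP[x _ ->].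
      by rewrite mem_nseq => /andP[_ /eqP ->]; exact: tent_ge0.
    - exact: sort_sorted ge_total _.
    - by rewrite /z; elim: size => [|[|n] IH] //=; rewrite lexx.
  by rewrite perm_sort perm_sym perm_cat2r perm_sort.
rewrite nth_cat; case: ltnP => // le_j.
by rewrite nth_nseq if_same nth_default.
Qed.

Lemma layer_default X j t : (size X <= j)%N -> layer X j t = 0.
Proof. by move=> Xj; rewrite /layer nth_default // size_sort size_map. Qed.

Lemma layer_mem X j t : layer X j t = 0 \/ exists2 x, x \in X & layer X j t = tent x t.
Proof.
case: (leqP (size X) j) => [/layer_default ->|j_lt]; first by left.
right; have : layer X j t \in sort >=%R [seq tent x t | x <- X].
  by rewrite mem_nth // size_sort size_map.
by rewrite mem_sort => /mapP[x xX ->]; exists x.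
Qed.

Lemma layer_dist X Y t n : size X = n -> size Y = n ->
  \sum_(0 <= i < n) (layer X i t - layer Y i t) ^+ 2
    <= \sum_(0 <= i < n) (tent (nth 0 X i) t - tent (nth 0 Y i) t) ^+ 2.
Proof.
move=> sX sY; apply: le_trans (sum_sort_dist _ _) _; rewrite ?size_map //.
rewrite le_eqVlt; apply/orP; left; apply/eqP.
by apply: eq_big_nat => i ?; rewrite !(nth_map 0) ?sX ?sY.
Qed.

(** Compares the lists of tent values at the two times; the constant is crude,
    as only continuity in time matters. *)
Lemma layer_lipschitz X j t t' : (forall x, x \in X -> x.1 <= x.2) ->
  `|layer X j t - layer X j t'| <= (size X)%:R * `|t - t'|.
Proof.
move=> wfX; case: (leqP (size X) j) => [Xj|j_lt].
  by rewrite !layer_default // subrr normr0 mulr_ge0.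
rewrite -(@ler_pXn2r _ 2) ?nnegrE ?mulr_ge0 // real_normK ?num_real //.
have := @sum_sort_dist _ [seq tent x t | x <- X] [seq tent x t' | x <- X]
  (size X) (size_map _ _) (size_map _ _).
rewrite big_mkord (bigD1 (Ordinal j_lt)) //= -/(layer X j t) -/(layer X j t').
move=> h; apply: le_trans (le_trans _ h) _.
  by rewrite lerDl sumr_ge0 // => i _; exact: sqr_ge0.
apply: le_trans (_ : _ <= \sum_(0 <= i < size X) `|t - t'| ^+ 2) _.
  apply: ler_sum_nat => i iX; rewrite !(nth_map 0) //.
  rewrite -[leLHS]real_normK ?num_real // ler_pXn2r ?nnegrE //.
  by apply: tent_lipschitz; apply: wfX; apply: mem_nth.
rewrite sumr_const_nat subn0 -[leLHS]mulr_natl exprMn ler_wpM2r ?sqr_ge0 //.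
by rewrite -natrX ler_nat -{1}[size X]expn1 leq_pexp2l // (leq_ltn_trans _ j_lt).
Qed.

End Layer.

(** * Square integrable sequences of functions *)

Section SquareIntegrable.
Variable R : realType.
Local Notation mu := (@lebesgue_measure R).
Implicit Types f g : R -> R.

Local Notation integrableT f := (mu.-integrable [set: R] (EFin \o f)).

Lemma dominated_integrable f g : measurable_fun [set: R] f ->
  (forall t, `|f t| <= g t) -> integrableT g -> integrableT f.
Proof.
move=> mf fg ig; apply: (le_integrable measurableT _ _ ig).
  exact/measurable_EFinP.
by move=> t _ /=; rewrite lee_fin (le_trans (fg t)) // ler_norm.
Qed.

Lemma integrableT_lin a b f g : integrableT f -> integrableT g ->
  integrableT (fun t => a * f t + b * g t).
Proof.
move=> /(integrableZl measurableT a) hf /(integrableZl measurableT b) hg.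
exact: (integrableD measurableT hf hg).
Qed.

Lemma integrableT_sum (I : Type) (s : seq I) (F : I -> R -> R) :
  (forall i, integrableT (F i)) -> integrableT (fun t => \sum_(i <- s) F i t).
Proof.
move=> hF; have := integrable_sum measurableT s (P := xpredT) (fun i _ => hF i).
apply: eq_integrable => // t _ /=.
by rewrite -sumEFin.
Qed.

Lemma Rintegral_sum (I : Type) (s : seq I) (F : I -> R -> R) :
  (forall i, integrableT (F i)) ->
  \int[mu]_t (\sum_(i <- s) F i t) = \sum_(i <- s) \int[mu]_t F i t.
Proof.
move=> hF; elim: s => [|i s IH].
  under eq_Rintegral do rewrite big_nil.
  by rewrite big_nil Rintegral_cst // mul0r.
under eq_Rintegral do rewrite big_cons.
by rewrite RintegralD // ?IH ?big_cons //; exact: integrableT_sum.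
Qed.

Lemma integrableT_indic (a b : R) : integrableT (\1_`[a, b]).
Proof. exact: integrable_indic_itv. Qed.

Lemma Rintegral_indic_itv (a b : R) : a <= b ->
  \int[mu]_t (\1_`[a, b] t) = b - a.
Proof.
move=> ab; rewrite /Rintegral integral_indic // setIT.
rewrite [X in fine X](_ : _ = lebesgue_measure `[a, b]) //.
rewrite lebesgue_measure_itv /=.
rewrite lte_fin; case: ltrP => [//|ba].
by rewrite (@le_anti _ _ a b) ?ab // subrr.
Qed.

Definition square_integrable f :=
  measurable_fun [set: R] f /\ integrableT (fun t => f t ^+ 2).

Lemma square_integrable_prod f g : square_integrable f -> square_integrable g ->
  integrableT (fun t => f t * g t).
Proof.
move=> [mf i_f] [mg i_g].
apply: (dominated_integrable _ _ (integrableT_lin 1 1 i_f i_g)).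
  exact: measurable_funM.
move=> t /=; rewrite !mul1r.
have := sqr_ge0 (f t + g t); have := sqr_ge0 (f t - g t).
rewrite ler_norml => h1 h2; apply/andP; split; nra.
Qed.

Lemma square_integrable_lin a f g : square_integrable f -> square_integrable g ->
  square_integrable (fun t => a * f t + g t).
Proof.
move=> [mf i_f] [mg i_g].
have mfg : measurable_fun [set: R] (fun t => a * f t + g t).
  by apply: measurable_funD => //; apply: measurable_funM.
split=> //.
apply: (dominated_integrable _ _ (integrableT_lin (2 * a ^+ 2) 2 i_f i_g)).
  exact: measurable_funX.
move=> t /=; rewrite ger0_norm ?sqr_ge0 //.
by have := sqr_ge0 (a * f t - g t); nra.
Qed.

(** Besides being square integrable, the sequences have finitely many nonzero
    terms, so that the limit in the inner product is a finite sum. *)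
Definition l2_sequence (u : nat -> R -> R) : Prop :=
  (forall j, square_integrable (u j)) /\
  exists N, forall j, (N < j)%N -> u j = fun=> 0.

Lemma landscape_innerE (u v : nat -> R -> R) N :
  (forall j, (N < j)%N -> u j = fun=> 0) ->
  landscape_inner u v = \sum_(1 <= j < N.+1) \int[mu]_t (u j t * v j t).
Proof.
move=> uN; rewrite /landscape_inner.
apply: (@lim_near_cst R) => //.
near=> n.
have Nn : (N.+1 <= n)%N by near: n; exact: nbhs_infty_ge.
rewrite (big_cat_nat _ Nn) //=.
rewrite [X in _ + X]big_nat_cond [X in _ + X]big1 ?addr0 // => j.
rewrite andbT => /andP[Nj _].
rewrite uN //; under eq_Rintegral do rewrite mul0r.
by rewrite Rintegral_cst // mul0r.
Unshelve. all: by end_near. Qed.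

Lemma l2_semi_inner : semi_inner l2_sequence (@landscape_inner R).
Proof.
split.
- move=> a u v [hu [M uM]] [hv [N vN]]; split.
    by move=> j; exact: square_integrable_lin.
  exists (maxn M N) => j; rewrite gtn_max => /andP[Mj Nj].
  by apply/funext => t /=; rewrite !fctE uM // vN // scaler0 addr0.
- move=> a u v w [hu [M uM]] [hv [N vN]] [hw _].
  pose K := maxn M N.
  have uK j : (K < j)%N -> u j = fun=> 0.
    by rewrite gtn_max => /andP[/uM].
  have vK j : (K < j)%N -> v j = fun=> 0.
    by rewrite gtn_max => /andP[_ /vN].
  rewrite (landscape_innerE _ uK) (landscape_innerE _ vK).
  rewrite (@landscape_innerE _ _ K); last first.
    move=> j Kj; apply/funext => t.
    by rewrite !fctE uK // vK // scaler0 addr0.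
  rewrite mulr_sumr -big_split; apply: eq_bigr => j _ /=.
  have iu := square_integrable_prod (hu j) (hw j).
  have iv := square_integrable_prod (hv j) (hw j).
  rewrite -RintegralZl // -RintegralD //; last exact: (integrableZl measurableT a iu).
  by apply: eq_Rintegral => t _; rewrite !fctE mulrDl mulrA.
- move=> u v [_ [M uM]] [_ [N vN]].
  rewrite (@landscape_innerE u v (maxn M N)); last first.
    by move=> j; rewrite gtn_max => /andP[/uM].
  rewrite (@landscape_innerE v u (maxn M N)); last first.
    by move=> j; rewrite gtn_max => /andP[_ /vN].
  by apply: eq_bigr => j _; apply: eq_Rintegral => t _; rewrite mulrC.
- move=> u [_ [M uM]]; rewrite (landscape_innerE _ uM).
  apply: sumr_ge0 => j _; apply: Rintegral_ge0 => t _.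
  by rewrite -expr2 sqr_ge0.
Qed.

End SquareIntegrable.

(** * Distance of layers in terms of distances of bars *)

Section LayerEnergy.
Variable R : realType.
Local Notation mu := (@lebesgue_measure R).
Implicit Types (X Y : seq (R * R)) (x y : R * R) (t : R).
Local Notation bar x := (\1_`[x.1, x.2]).

Lemma lipschitz_continuous (f : R -> R) (k : R) : 0 <= k ->
  (forall t t', `|f t - f t'| <= k * `|t - t'|) -> continuous f.
Proof.
move=> k_ge0 fk t; have k1_gt0 : 0 < k + 1 by rewrite ltr_wpDl.
apply/cvgrPdist_le => e e_gt0; near=> t'.
apply: le_trans (fk _ _) _.
apply: (@le_trans _ _ ((k + 1) * `|t - t'|)).
  by rewrite ler_wpM2r // lerDl.
rewrite mulrC -ler_pdivlMr //; near: t'.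
have ek_gt0 : 0 < e / (k + 1) by exact: divr_gt0.
by apply: filterS (nbhsx_ballx t _ ek_gt0) => s /ltW.
Unshelve. all: by end_near. Qed.

Lemma barE x t : bar x t = (x.1 <= t <= x.2)%R%:R :> R.
Proof. by rewrite indicE mem_setE in_itv. Qed.

Lemma tent_sqr_le x t : x.1 <= x.2 ->
  tent x t ^+ 2 <= (x.2 - x.1) ^+ 2 * bar x t.
Proof.
move=> x12; rewrite barE; case: (boolP (_ <= t <= _)) => [/andP[? ?]|xt] /=.
  rewrite mulr1 ler_pXn2r ?nnegrE ?tent_ge0 ?subr_ge0 //.
  rewrite tentE // ge_max subr_ge0 x12 /=.
  by rewrite ge_min; apply/orP; left; rewrite lerD2r.
by rewrite tent_out // expr0n mulr0.
Qed.

Lemma tent_dist_sqr_le x y t : x.1 <= x.2 -> y.1 <= y.2 ->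
  (tent x t - tent y t) ^+ 2 <= `|x - y| ^+ 2 * (bar x t + bar y t).
Proof.
move=> x12 y12; rewrite !barE.
have [xy|] := boolP ((x.1 <= t <= x.2) || (y.1 <= t <= y.2)).
  apply: (@le_trans _ _ (`|x - y| ^+ 2)).
    rewrite -[leLHS]real_normK ?num_real // ler_pXn2r ?nnegrE //.
    exact: tent_dist.
  rewrite ler_peMr ?sqr_ge0 // -natrD (ler_nat R 1).
  by move: xy; do 2![case: (_ <= t <= _)].
rewrite negb_or => /andP[xt yt].
by rewrite !tent_out // subrr expr0n mulr_ge0 ?sqr_ge0 // addr_ge0.
Qed.

Lemma layer_square_integrable X j : (forall x, x \in X -> x.1 <= x.2) ->
  square_integrable (layer X j).
Proof.
move=> wfX; have mX : measurable_fun [set: R] (layer X j).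
  apply: continuous_measurable_fun.
  by apply: (@lipschitz_continuous _ (size X)%:R) => // t t'; exact: layer_lipschitz.
split=> //; pose g t := \sum_(x <- X) (x.2 - x.1) ^+ 2 * bar x t.
apply: (@dominated_integrable _ _ g); first exact: measurable_funX.
  move=> t; rewrite ger0_norm ?sqr_ge0 //.
  have g_ge0 x : 0 <= (x.2 - x.1) ^+ 2 * bar x t.
    by rewrite mulr_ge0 ?sqr_ge0 // barE.
  have [->|[x xX ->]] := layer_mem X j t.
    by rewrite expr0n; apply: sumr_ge0.
  apply: le_trans (tent_sqr_le _ (wfX x xX)) _.
  by rewrite /g (big_rem x) //= lerDl; apply: sumr_ge0.
apply: integrableT_sum => x.
exact: (integrableZl measurableT _ (integrableT_indic _ _)).
Qed.

(** Integrates [layer_dist].  The matched tents differ by at most the distance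
    [e] of their points, over two intervals of lengths at most [L] and
    [L + 2 * e]. *)
Lemma layer_energy_dist X Y n (L : R) : size X = n -> size Y = n ->
  (forall x, x \in X -> x.1 <= x.2) -> (forall y, y \in Y -> y.1 <= y.2) ->
  (forall x, x \in X -> x.2 - x.1 <= L) ->
  \sum_(0 <= i < n) \int[mu]_t ((layer X i t - layer Y i t) ^+ 2)
    <= \sum_(0 <= i < n) `|nth 0 X i - nth 0 Y i| ^+ 2
         * (2 * L + 2 * `|nth 0 X i - nth 0 Y i|).
Proof.
move=> sX sY wfX wfY XL.
have wf_nth Z i : (forall z, z \in Z -> z.1 <= z.2) ->
    (nth 0 Z i).1 <= (nth 0 Z i).2 :> R.
  move=> wfZ; have [iZ|Zi] := ltnP i (size Z); first by rewrite wfZ ?mem_nth.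
  by rewrite nth_default.
pose x i := nth 0 X i; pose y i := nth 0 Y i.
pose g i t := `|x i - y i| ^+ 2 * (bar (x i) t + bar (y i) t).
have ibar i : mu.-integrable [set: R]
    (EFin \o (fun t => bar (x i) t + bar (y i) t)).
  exact: (integrableD measurableT (integrableT_indic _ _) (integrableT_indic _ _)).
have ig i : mu.-integrable [set: R] (EFin \o g i).
  exact: (integrableZl measurableT _ (ibar i)).
have il i : mu.-integrable [set: R]
    (EFin \o (fun t => (layer X i t - layer Y i t) ^+ 2)).
  have [_] := square_integrable_lin (-1)
    (layer_square_integrable i wfY) (layer_square_integrable i wfX).
  apply: eq_integrable => // t _ /=.
  by rewrite mulN1r addrC.
rewrite -Rintegral_sum //.
apply: (@le_trans _ _ (\int[mu]_t (\sum_(0 <= i < n) g i t))).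
  apply: le_Rintegral => //; [exact: integrableT_sum|exact: integrableT_sum|].
  move=> t _; apply: le_trans (layer_dist t sX sY) _.
  by apply: ler_sum => i _; apply: tent_dist_sqr_le; exact: wf_nth.
rewrite Rintegral_sum //; apply: ler_sum_nat => i /= iN.
rewrite RintegralZl // RintegralD ?Rintegral_indic_itv ?wf_nth //;
  try exact: integrableT_indic.
rewrite ler_wpM2l ?sqr_ge0 //.
have := length_dist (x i) (y i).
have : (x i).2 - (x i).1 <= L by apply: XL; rewrite mem_nth ?sX.
rewrite -/(x i) -/(y i); lra.
Qed.

End LayerEnergy.

(** * Landscapes and matchings of diagrams *)

Section Matching.
Variable R : realType.
Implicit Types D E F : {mset R * R}.

Lemma perm_msetD D E : perm_eq (D `+` E)%mset (D ++ E).
Proof.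
by apply/allP => x _ /=; rewrite count_cat !count_mem_mset msetE2.
Qed.

Lemma landscapeE D j : landscape D j = layer D j.-1.
Proof. by []. Qed.

Lemma landscape_augmentation theta0 D E : diagonal_augmentation theta0 D E ->
  landscape D = landscape E.
Proof.
move=> [F diagF ->]; apply/funext => j; rewrite !landscapeE.
rewrite (layer_perm (perm_msetD D F)) layer_cat_diag // => y yF.
by have [a _ ->] := diagF _ yF.
Qed.

Lemma augmentation_mem theta0 D E x : diagonal_augmentation theta0 D E ->
  x \in E -> x \in D \/ x.1 = x.2.
Proof.
move=> [F diagF ->]; rewrite in_msetD => /orP[xD|xF]; first by left.
by right; have [a _ ->] := diagF _ xF.
Qed.

Lemma landscape_l2 theta0 D : persistence_diagram theta0 D ->
  l2_sequence (landscape D).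
Proof.
move=> pd; split=> [j|].
  by apply: layer_square_integrable => x /pd[_ /ltW].
exists (size D) => -[//|j] Dj; apply/funext => t.
exact: layer_default.
Qed.

(** Listing the bars of [E'] along the matching [gamma] changes neither the
    landscape of [E'] nor, by [landscape_augmentation], that of [D']. *)
Lemma landscape_matching theta0 D D' E E' (gamma : 'I_(size E) -> 'I_(size E'))
    (L : R) :
  persistence_diagram theta0 D -> persistence_diagram theta0 D' ->
  diagonal_augmentation theta0 D E -> diagonal_augmentation theta0 D' E' ->
  bijective gamma -> 0 <= L -> (forall x, x \in D -> x.2 - x.1 <= L) ->
  landscape_inner (landscape D - landscape D') (landscape D - landscape D')
    <= \sum_i displacement gamma i ^+ 2 * (2 * L + 2 * displacement gamma i).
Proof.
move=> pdD pdD' augD augD' gamma_bij L_ge0 DL.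
have wfE x : x \in E -> x.1 <= x.2.
  by move=> /(augmentation_mem augD)[/pdD[_ /ltW]|->].
have wfE' x : x \in E' -> x.1 <= x.2.
  by move=> /(augmentation_mem augD')[/pdD'[_ /ltW]|->].
have EL x : x \in E -> x.2 - x.1 <= L.
  by move=> /(augmentation_mem augD)[/DL|->] //; rewrite subrr.
rewrite (landscape_augmentation augD) (landscape_augmentation augD').
pose Y := [seq nth 0 E' (gamma i) | i <- enum 'I_(size E)].
have YE' : perm_eq E' Y.
  have gammaE : perm_eq (enum 'I_(size E')) [seq gamma i | i <- enum 'I_(size E)].
    apply: uniq_perm; rewrite ?enum_uniq //.
      by rewrite map_inj_uniq ?enum_uniq //; exact: bij_inj.
    move=> k; rewrite mem_enum; apply/esym/mapP.
    have [gamma' _ gammaK] := gamma_bij.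
    by exists (gamma' k); rewrite ?mem_enum // gammaK.
  rewrite /Y (map_comp (fun k : 'I_(size E') => nth 0 E' k) gamma).
  apply: perm_trans (perm_map _ gammaE).
  by rewrite (map_comp (nth 0 E') val) val_enum_ord map_nth_iota0 // take_size.
have sY : size Y = size E by rewrite size_map size_enum_ord.
have wfY y : y \in Y -> y.1 <= y.2 by rewrite -(perm_mem YE'); exact: wfE'.
have NE j : (size E < j)%N -> (landscape E - landscape E') j = fun=> 0.
  case: j => // j Ej; apply/funext => t; rewrite !fctE.
  rewrite !landscapeE (layer_perm YE') !layer_default ?sY //.
  by rewrite subr0.
rewrite (landscape_innerE _ NE) big_add1 /=.
have := layer_energy_dist (erefl (size E)) sY wfE wfY EL.
rewrite [in X in _ <= X -> _]big_mkord => h.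
apply: le_trans (le_trans h _); last first.
  apply: ler_sum => i _; rewrite /displacement.
  by rewrite /Y (nth_map i) ?size_enum_ord // nth_ord_enum.
apply: ler_sum => j _; rewrite le_eqVlt; apply/orP; left; apply/eqP.
apply: eq_Rintegral => t _; rewrite !fctE expr2 -(layer_perm YE').
by [].
Qed.

(** A matching of cost [r <= 2] puts the landscapes at distance at most
    [c * r], where [c ^+ 2 = 2 * L + 4] and [L] is the total length of the bars
    of [D].  If the distance were larger than [c] times the infimum of the
    costs, some matching of cost below 2 would contradict this.  The infimum is
    that of a nonempty set: both diagrams can be padded to the same size. *)
Lemma landscape_dist_wasserstein theta0 D : persistence_diagram theta0 D ->
  exists2 c : R, 0 < c & forall D', persistence_diagram theta0 D' ->
    wasserstein theta0 2 D D' <= 1 ->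
    landscape_norm (landscape D - landscape D') <= c * wasserstein theta0 2 D D'.
Proof.
move=> pdD; pose L : R := \sum_(x <- D) (x.2 - x.1).
have len_ge0 x : x \in D -> 0 <= x.2 - x.1 by move=> /pdD[_ /ltW]; rewrite subr_ge0.
have L_ge0 : 0 <= L by rewrite /L big_seq sumr_ge0.
have DL x : x \in D -> x.2 - x.1 <= L.
  move=> xD; rewrite /L (big_rem x) //= lerDl big_seq sumr_ge0 // => y /mem_rem.
  exact: len_ge0.
pose c := Num.sqrt (2 * L + 4); have c_gt0 : 0 < c by rewrite sqrtr_gt0; lra.
exists c => // D' pdD' W_le1.
set N := landscape_norm _; rewrite leNgt; apply/negP => W_lt.
have : wasserstein theta0 2 D D' < Num.min 2 (N / c).
  rewrite lt_min (le_lt_trans W_le1) ?ltr1n //=.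
  by rewrite ltr_pdivlMr // mulrC.
move=> /inf_lt[].
  (* pads each diagram with as many diagonal points as the other has bars *)
  pose F := msetn (size D') (theta0, theta0) : {mset R * R}.
  pose F' := msetn (size D) (theta0, theta0) : {mset R * R}.
  have diag n x : x \in (msetn n (theta0, theta0) : {mset R * R}) ->
      pd_diagonal theta0 x.
    by rewrite in_msetn => /andP[_ /eqP->]; exists theta0.
  have sE : size (D `+` F)%mset = size (D' `+` F')%mset.
    rewrite !(perm_size (perm_msetD _ _)) !size_cat /F /F' !enum_msetn !size_nseq.
    by rewrite addnC.
  exists ((\sum_i displacement (cast_ord sE) i `^ 2) `^ 2^-1).
  exists (D `+` F)%mset, (D' `+` F')%mset, (cast_ord sE); split=> //.
  - by exists F => // x; exact: diag.
  - by exists F' => // x; exact: diag.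
move=> r [E [E' [gamma [augD augD' gamma_bij rE]]]].
have disp_ge0 i : 0 <= displacement gamma i by exact: normr_ge0.
have S_ge0 : 0 <= \sum_i displacement gamma i ^+ 2.
  by apply: sumr_ge0 => i _; exact: sqr_ge0.
have {}rE : r = Num.sqrt (\sum_i displacement gamma i ^+ 2).
  rewrite rE powR12_sqrt; last by apply: sumr_ge0 => i _; exact: powR_ge0.
  by congr Num.sqrt; apply: eq_bigr => i _; rewrite powR_mulrn.
have r_ge0 : 0 <= r by rewrite rE sqrtr_ge0.
have r2 : r ^+ 2 = \sum_i displacement gamma i ^+ 2 by rewrite rE sqr_sqrtr.
have disp_le i : displacement gamma i <= r.
  rewrite -(@ler_pXn2r _ 2) ?nnegrE // r2 (bigD1 i) //= lerDl.
  by apply: sumr_ge0 => k _; exact: sqr_ge0.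
rewrite lt_min => /andP[r_lt2]; rewrite ltr_pdivlMr // ltNge => /negP; apply.
apply: (@le_trans _ _ (Num.sqrt ((2 * L + 4) * r ^+ 2))); last first.
  by rewrite sqrtrM ?sqrtr_sqr ?(ger0_norm r_ge0) 1?mulrC //; lra.
apply: ler_wsqrtr.
apply: le_trans (landscape_matching pdD pdD' augD augD' gamma_bij L_ge0 DL) _.
rewrite r2 mulr_sumr; apply: ler_sum => i _; rewrite mulrC ler_wpM2r ?sqr_ge0 //.
by have := disp_le i; lra.
Qed.

End Matching.

(** * Stability of the cosine similarity *)

Theorem proposition1 (R : realType) (theta0 : R) (D1 D2 : {mset R * R})
  (hD1 : persistence_diagram theta0 D1) (hD2 : persistence_diagram theta0 D2)
  (hD1_neq0 : D1 <> mset0) (hD2_neq0 : D2 <> mset0)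
  (eta : R) (heta : 0 < eta)
  (heta2 : eta ^+ 2 =
    Num.min 1
      (Num.min
        (landscape_norm (landscape D1) ^+ 2 / 8 *
           (bottleneck theta0 D1 mset0 + 1 / 3)^-1)
        (landscape_norm (landscape D2) ^+ 2 / 8 *
           (bottleneck theta0 D2 mset0 + 1 / 3)^-1))) :
  exists c1 c2 : R,
    [/\ 0 < c1, 0 < c2 &
      forall D1' D2' : {mset R * R},
        persistence_diagram theta0 D1' -> persistence_diagram theta0 D2' ->
        D1' <> mset0 -> D2' <> mset0 ->
        wasserstein theta0 2 D1 D1' <= eta ->
        wasserstein theta0 2 D2 D2' <= eta ->
        `|cosine_similarity D1' D2' - cosine_similarity D1 D2|
          <= c1 * wasserstein theta0 2 D1 D1'
             + c2 * wasserstein theta0 2 D2 D2'].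
Proof.
have eta2_gt0 : 0 < eta ^+ 2 by rewrite exprn_gt0.
have eta_le1 : eta <= 1.
  have : eta ^+ 2 <= 1 by rewrite heta2 ge_min lexx.
  by rewrite expr_le1 // ltW.
(* the landscapes do not vanish, since [eta] does not *)
have norm_gt0 (a b : R) : 0 < Num.sqrt a ^+ 2 / 8 * b -> 0 < Num.sqrt a.
  move=> h; rewrite lt_neqAle sqrtr_ge0 andbT eq_sym; apply/eqP => a0.
  by move: h; rewrite a0 expr0n /= !mul0r ltxx.
move: eta2_gt0; rewrite heta2 !lt_min => /and3P[_ /norm_gt0 n1 /norm_gt0 n2].
have quotient_gt0 (a : R) : 0 < a -> 0 < 2 / a by move=> ?; exact: divr_gt0.
have product_gt0 (a b : R) : 0 < a -> 0 < b -> 0 < a * b by exact: mulr_gt0.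
have [k1 k1_gt0 hk1] := landscape_dist_wasserstein hD1.
have [k2 k2_gt0 hk2] := landscape_dist_wasserstein hD2.
exists (2 / landscape_norm (landscape D1) * k1).
exists (2 / landscape_norm (landscape D2) * k2).
have d1 := quotient_gt0 _ n1; have d2 := quotient_gt0 _ n2.
split; [exact: product_gt0 d1 k1_gt0|exact: product_gt0 d2 k2_gt0|].
move=> D1' D2' hD1' hD2' _ _ w1 w2.
have key := semi_inner_cosine_dist (l2_semi_inner R) (landscape_l2 hD1)
  (landscape_l2 hD1') (landscape_l2 hD2) (landscape_l2 hD2') n1 n2.
apply: (le_trans key); apply: lerD; rewrite -[leRHS]mulrA.
  by rewrite (ler_pM2l d1); apply: hk1 => //; exact: le_trans w1 eta_le1.
by rewrite (ler_pM2l d2); apply: hk2 => //; exact: le_trans w2 eta_le1.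
Qed.
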